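(* Let $d,p\ge 1$ be integers and let $f:\mathbb{R}^d\to\mathbb{R}$ be a $p$-th order truncated Volterra mapping, $f=\sum_{r=1}^p f_r$, with $r$-th order components $f_r$. Then for each order $r\in\{1,\ldots,p\}$ there exist a finite integer $M_r$ and parameters $\gamma_{r,1},\ldots,\gamma_{r,M_r}\in\mathbb{R}$ and $w_{r,1},\ldots,w_{r,M_r}\in\mathbb{R}^d$ such that $$f_r(x)=\sum_{i=1}^{M_r}\gamma_{r,i}\,(x^\top w_{r,i})^r\qquad\text{for all }x\in\mathbb{R}^d.$$ Consequently, $$f(x)=\sum_{r=1}^{p}\sum_{i=1}^{M_r}\gamma_{r,i}\,(x^\top w_{r,i})^r\qquad\text{for all }x\in\mathbb{R}^d.$$
   Context: A $p$-th order truncated Volterra mapping is a function $f:\mathbb{R}^d\to\mathbb{R}$ of the form $f(x)=\sum_{r=1}^{p} f_r(x)$, where the $r$-th order component $f_r$ is a homogeneous polynomial of degree $r$ in $x=(x_1,\ldots,x_d)$, that is, $$f_r(x)=\sum_{i_1=1}^{d}\cdots\sum_{i_r=1}^{d} h_r(i_1,\ldots,i_r)\,x_{i_1}\cdots x_{i_r}$$ for some real coefficients $h_r(i_1,\ldots,i_r)$ (the zero polynomial is allowed). The constant (order-$0$) term is taken to be $0$. *)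

(* Defs.v *)
From mathcomp Require Import all_boot all_order all_algebra.
From mathcomp Require Import reals.

Set Implicit Arguments.
Unset Strict Implicit.
Unset Printing Implicit Defensive.

Import GRing.Theory.

Local Open Scope ring_scope.

(* A multi-index (i_1, ..., i_r) is an r-tuple [i]; its entries may repeat and
   the kernel [h] need not be symmetric. *)
Definition volterra_form (R : realType) (d r : nat)
    (h : r.-tuple 'I_d -> R) (x : 'cV[R]_d) : R :=
  \sum_(i : r.-tuple 'I_d) h i * \prod_(k < r) x (tnth i k) 0.

Definition homogeneous_poly_fun (R : realType) (d r : nat)
    (g : 'cV[R]_d -> R) : Prop :=
  exists h : r.-tuple 'I_d -> R, forall x : 'cV[R]_d, g x = volterra_form h x.

(* [f] is a truncated Volterra mapping of order [p] whose component of order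
   [r] is [F r]; the values of [F] outside [1 <= r <= p] are irrelevant. *)
Definition volterra_mapping (R : realType) (d p : nat)
    (f : 'cV[R]_d -> R) (F : nat -> 'cV[R]_d -> R) : Prop :=
  (forall r : nat, (1 <= r <= p)%N -> homogeneous_poly_fun r (F r)) /\
  (forall x : 'cV[R]_d, f x = \sum_(1 <= r < p.+1) F r x).

Definition dotp (R : realType) (d : nat) (x w : 'cV[R]_d) : R :=
  (x^T *m w) 0 0.

(* Main.v *)
(** Polarization writes a product of [r] linear forms as a combination of [r]-th
    powers: in the signed sum over [b : 'I_r -> bool] of [(\sum_k b_k a_k)^r],
    the monomial [\prod_i a_(g i)] gets the coefficient
    [\prod_k (0 ^ #|g^-1(k)| - 1)], which vanishes unless [g] is a bijection.
    Hence only [r! (-1)^r \prod_k a_k] survives, and each monomial of [F r] is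
    polarized separately. *)
Require Import Defs.
From mathcomp Require Import all_boot all_order all_algebra.
From mathcomp Require Import boolp reals.

Import GRing.Theory Num.Theory.

Local Open Scope ring_scope.

(** Grouping the factors [b (g i)] by fibres of [g] makes the summand a product over [k] of terms in
    [b k] alone. The sum then factors: [b k = false] contributes [0 ^+ m], with [m] the size of the
    fibre, and [b k = true] contributes [-1]. *)
Lemma sum_signed_indicator (R : comNzRingType) (n r : nat) (g : 'I_r -> 'I_n) :
  \sum_(b : {ffun 'I_n -> bool})
     (\prod_k (-1) ^+ b k) * \prod_i (b (g i))%:R
  = \prod_k (0 ^+ #|[pred i | g i == k]| - 1) :> R.
Proof.
pose c k (e : bool) : R := (-1) ^+ e * e%:R ^+ #|[pred i | g i == k]|.
transitivity (\sum_(b : {ffun 'I_n -> bool}) \prod_k c k (b k)).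
  apply: eq_bigr => b _; rewrite big_split /=; congr (_ * _).
  rewrite (partition_big g xpredT) //=; apply: eq_bigr => k _.
  by rewrite -prodr_const; apply: eq_bigr => i /eqP ->.
rewrite -bigA_distr_bigA; apply: eq_bigr => k _.
by rewrite big_bool /c /= expr1 expr0 expr1n mulr1 mul1r addrC.
Qed.

(** For injective [g] all fibres are singletons and each factor is [-1]. Otherwise some fibre is
    empty, and its factor vanishes because [0 ^+ 0 = 1]. *)
Lemma prod_fiber_sign (R : comNzRingType) (r : nat) (g : 'I_r -> 'I_r) :
  \prod_k (0 ^+ #|[pred i | g i == k]| - 1)
  = (if injectiveb g then (-1) ^+ r else 0) :> R.
Proof.
case: injectiveP => [g_inj | g_ninj].
  have [h hK gK] := injF_bij g_inj.
  rewrite (eq_bigr (fun=> -1)) => [|k _]; first by rewrite prodr_const card_ord.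
  rewrite (_ : #|_| = 1%N) ?expr1 ?sub0r //.
  rewrite -(card1 (h k)); apply: eq_card => i.
  by rewrite !inE -{1}(gK k) (inj_eq g_inj).
have [k gk0] : exists k, #|[pred i | g i == k]| == 0%N.
  apply/existsP; apply: contra_notT g_ninj => /existsPn g_surj.
  have g_onto k : exists i, g i == k by apply/existsP; exact: g_surj.
  (* A section of a surjective [g] is injective, hence bijective by finiteness, so [g], its inverse,
     is injective too. *)
  have sK : cancel (fun k => xchoose (g_onto k)) g.
    by move=> k; apply/eqP; exact: (xchooseP (g_onto k)).
  exact: bij_inj (bij_can_bij (injF_bij (can_inj sK)) sK).
by rewrite (bigD1 k) //= (eqP gk0) expr0 subrr mul0r.
Qed.

Lemma polarization (R : comNzRingType) (r : nat) (a : 'I_r -> R) :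
  \sum_(b : {ffun 'I_r -> bool})
     (\prod_k (-1) ^+ b k) * (\sum_k (b k)%:R * a k) ^+ r
  = (-1) ^+ r * r`!%:R * \prod_k a k.
Proof.
transitivity (\sum_(g : {ffun 'I_r -> 'I_r})
    (if injectiveb g then (-1) ^+ r else 0) * \prod_i a (g i)).
  under [RHS]eq_bigr => g _ do rewrite -prod_fiber_sign -sum_signed_indicator.
  under [RHS]eq_bigr => g _ do rewrite mulr_suml.
  rewrite exchange_big /=; apply: eq_bigr => b _.
  (* The power becomes a product over ['I_r], so that distributivity expands it into a sum over the
     maps [g]. *)
  rewrite -[r in _ ^+ r]card_ord -prodr_const bigA_distr_bigA mulr_sumr.
  by apply: eq_bigr => g _; rewrite big_split mulrA.
rewrite (bigID (fun g : {ffun _} => injectiveb g)) /= [X in _ + X]big1 ?addr0.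
  rewrite (eq_bigr (fun=> (-1) ^+ r * \prod_k a k)) => [|g g_inj].
    rewrite sumr_const -cardsE card_inj_ffuns card_ord ffactnn.
    by rewrite mulrAC mulr_natr.
  rewrite g_inj; congr (_ * _).
  by rewrite [RHS](reindex_inj (injectiveP _ g_inj)).
by move=> g /negbTE ->; rewrite mul0r.
Qed.

Lemma dotp_sum_delta (R : realType) (d r : nat) (x : 'cV[R]_d)
    (i : r.-tuple 'I_d) (c : 'I_r -> R) :
  dotp x (\sum_k c k *: delta_mx (tnth i k) 0) = \sum_k c k * x (tnth i k) 0.
Proof.
rewrite /dotp mulmx_sumr summxE; apply: eq_bigr => k _.
by rewrite -scalemxAr mxE -colE !mxE.
Qed.

Definition ridge_index (d r : nat) : finType :=
  (r.-tuple 'I_d * {ffun 'I_r -> bool})%type.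

(** The inverse cancels the constant produced by [polarization]; the signs are those of its sum. *)
Definition ridge_weight {R : realType} {d r : nat} (h : r.-tuple 'I_d -> R)
    (u : ridge_index d r) : R :=
  h u.1 * ((-1) ^+ r * r`!%:R)^-1 * \prod_k (-1) ^+ u.2 k.

Definition ridge_direction (R : realType) {d r : nat} (u : ridge_index d r) :
    'cV[R]_d :=
  \sum_k (u.2 k)%:R *: delta_mx (tnth u.1 k) 0.

Lemma volterra_form_ridge (R : realType) (d r : nat) (h : r.-tuple 'I_d -> R)
    (x : 'cV[R]_d) :
  volterra_form h x =
  \sum_(u : ridge_index d r)
     ridge_weight h u * dotp x (ridge_direction R u) ^+ r.
Proof.
rewrite -(pair_bigA _ (fun i b => ridge_weight h (i, b) *
                                  dotp x (ridge_direction R (i, b)) ^+ r)) /=.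
apply: eq_bigr => i _; rewrite /ridge_weight /ridge_direction /=.
under [RHS]eq_bigr => b _ do rewrite dotp_sum_delta -mulrA.
(* Characteristic zero enters here: [r!] must be invertible. *)
have nz : (-1) ^+ r * r`!%:R != 0 :> R.
  by rewrite mulf_neq0 ?signr_eq0 // pnatr_eq0 -lt0n fact_gt0.
by rewrite -mulr_sumr polarization -mulrA mulKf.
Qed.

Theorem theorem3 (R : realType) (d p : nat) (hd : (1 <= d)%N) (hp : (1 <= p)%N)
    (f : 'cV[R]_d -> R) (F : nat -> 'cV[R]_d -> R)
    (hf : volterra_mapping p f F) :
  exists (M : nat -> nat)
         (gamma : forall r : nat, 'I_(M r) -> R)
         (w : forall r : nat, 'I_(M r) -> 'cV[R]_d),
    (forall r : nat, (1 <= r <= p)%N ->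
       forall x : 'cV[R]_d,
         F r x = \sum_(i < M r) gamma r i * dotp x (w r i) ^+ r) /\
    (forall x : 'cV[R]_d,
       f x = \sum_(1 <= r < p.+1)
               \sum_(i < M r) gamma r i * dotp x (w r i) ^+ r).
Proof.
have [F_hom fE] := hf.
(* The witnesses must be defined for every [r], so the kernel is chosen for all orders at once, with
   the zero kernel as default out of range. *)
have /(_ _)/cid kernel r : exists h : r.-tuple 'I_d -> R,
    (1 <= r <= p)%N -> forall x, F r x = volterra_form h x.
  have [/F_hom[h hE] | _] := boolP (1 <= r <= p)%N; first by exists h.
  by exists (fun=> 0).
pose h r := sval (kernel r).
exists (fun r => #|ridge_index d r|).
exists (fun r i => ridge_weight (h r) (enum_val i)).
exists (fun r i => ridge_direction R (enum_val i)).
have FE r : (1 <= r <= p)%N -> forall x, F r x =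
    \sum_(i < #|ridge_index d r|) ridge_weight (h r) (enum_val i) *
      dotp x (ridge_direction R (enum_val i)) ^+ r.
  move=> r_bd x; rewrite (svalP (kernel r) r_bd) volterra_form_ridge.
  exact: (reindex _ (onW_bij _ (@enum_val_bij (ridge_index d r)))).
split=> // x; rewrite fE; apply: eq_big_nat => r r_bd; exact: FE.
Qed.
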